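(* Let $n\in\mathbb{N}$, let $1\le k\le n$, let $L:\mathbb{R}^n\to\mathbb{R}^k$ be a surjective linear map and let $a\in\mathbb{R}^k$. Then every local extreme point of the hyperbolic slice $\mathcal{H}_L(a)$ lies in its $k$-boundary, i.e. $\operatorname{locextr}(\mathcal{H}_L(a))\subseteq \mathcal{H}_L^k(a)$.
   Context: For $z\in\mathbb{R}^n$ let $f_z:=T^n-z_1T^{n-1}+\dots+(-1)^nz_n\in\mathbb{R}[T]$. Let $\mathcal{H}:=\{z\in\mathbb{R}^n : f_z \text{ has only real roots}\}$ and, for $1\le m\le n$, let $\mathcal{H}^m:=\{z\in\mathcal{H} : f_z\text{ has at most } m \text{ distinct roots}\}$. The hyperbolic slice associated with $L$ and $a$ is $\mathcal{H}_L(a):=\mathcal{H}\cap L^{-1}(a)$, and $\mathcal{H}_L^m(a):=\mathcal{H}^m\cap L^{-1}(a)$ is its $m$-boundary. For $A\subseteq\mathbb{R}^n$, a point $z\in A$ is a local extreme point of $A$ if there is a neighborhood $U\subseteq\mathbb{R}^n$ of $z$ such that $z$ is an extreme point of $\operatorname{conv}(A\cap U)$. The set of local extreme points of $A$ is denoted $\operatorname{locextr}(A)$. *)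

(* Defs.v *)
From HB Require Import structures.
From mathcomp Require Import all_boot all_order all_algebra.
From mathcomp Require Import complex.
From mathcomp Require Import all_classical all_reals all_analysis.

Set Implicit Arguments.
Unset Strict Implicit.
Unset Printing Implicit Defensive.

Import Order.TTheory GRing.Theory Num.Theory.
Import numFieldNormedType.Exports.

Local Open Scope classical_set_scope.
Local Open Scope ring_scope.
Local Open Scope card_scope.
Local Open Scope convex_scope.

Section Convexity.
Context {R : realType} {V : lmodType R}.

Definition conv_hull (A : set V) : set V :=
  smallest (@convex_set R V) A.

Definition extreme_point (C : set V) (z : V) : Prop :=
  C z /\
  forall (x y : convex_lmodType V) (t : {i01 R}), C x -> C y ->
    0 < t%:num -> t%:num < 1 -> z = x <| t |> y -> x = z /\ y = z.

End Convexity.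

Section HyperbolicSlices.
Context {R : realType}.

(* Neighbourhoods in 'rV_n are those of the sup norm, i.e. the usual ones. *)
Definition locextr n (A : set 'rV[R]_n) : set 'rV[R]_n :=
  [set z | A z /\
    exists U : set 'rV[R]_n, nbhs z U /\ extreme_point (conv_hull (A `&` U)) z].

(* The coordinates z_1, ..., z_n are z 0 0, ..., z 0 (n-1). *)
Definition fpoly n (z : 'rV[R]_n) : {poly R} :=
  'X^n + \sum_(i < n) ((-1) ^+ i.+1 * z 0 i) *: 'X^(n - i.+1).

(* "Only real roots" is a condition on the complex roots. *)
Definition hyperbolic n : set 'rV[R]_n :=
  [set z | forall c : R[i],
     root (map_poly (real_complex R) (fpoly z)) c -> complex.Im c = 0].

(* Real roots suffice here: a hyperbolic polynomial has no others. *)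
Definition hyperbolic_strat n (m : nat) : set 'rV[R]_n :=
  [set z | hyperbolic z /\ [set x : R | root (fpoly z) x] #<= `I_m].

Definition hyperbolic_slice n k (L : 'rV[R]_n -> 'rV[R]_k) (a : 'rV[R]_k) :
    set 'rV[R]_n :=
  @hyperbolic n `&` L @^-1` [set a].

Definition hyperbolic_slice_boundary n k (m : nat)
    (L : 'rV[R]_n -> 'rV[R]_k) (a : 'rV[R]_k) : set 'rV[R]_n :=
  @hyperbolic_strat n m `&` L @^-1` [set a].

End HyperbolicSlices.

(* Main.v *)
(** Suppose [z] lies in the slice and [fpoly z] has [k.+1] distinct real roots.
    Write [fpoly z = r * q], where [q] is the product of the corresponding linear
    factors.  Perturbing [q] by a small multiple of a polynomial [h] of degree at
    most [k] keeps it real-rooted, so [fpoly z + e *: (r * h)] is again hyperbolic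
    for all small [e].  These [h] form a space of dimension [k.+1], whence some
    nonzero [h] gives a direction in the kernel of [L], and [z] is the midpoint of
    a nontrivial segment inside the slice. *)
Require Import Defs.
From HB Require Import structures.
From mathcomp Require Import all_boot all_order all_algebra.
From mathcomp Require Import complex.
From mathcomp Require Import all_classical all_reals all_analysis.
From mathcomp Require polyrcf.
From mathcomp Require Import ring lra.

Import Order.TTheory GRing.Theory Num.Theory.
Import numFieldNormedType.Exports.

Set Implicit Arguments.
Unset Strict Implicit.

Local Open Scope classical_set_scope.
Local Open Scope ring_scope.

(** Turns the failure of a bound on the number of roots into an indexed family of distinct roots,
    ready for a product. *)
Lemma card_gt_inj (T : pointedType) (A : set T) (k : nat) :
  ~ (A #<= `I_k)%card ->
  exists2 x : 'I_k.+1 -> T, injective x & forall i, A (x i).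
Proof.
move=> nAk.
have /pcard_leP[f] : (`I_k.+1 #<= A)%card.
  have [[m Am]|/infiniteP] := pselect (finite_set A); last first.
    by apply: card_le_trans; exact: card_leT.
  rewrite (card_le_eqr Am) card_le_II ltnNge; apply/negP => mk.
  by apply: nAk; rewrite (card_le_eql Am) card_le_II.
exists (fun i => f (nat_of_ord i)) => [i j fij|i].
  by apply/val_inj/(@inj _ _ _ f) => //; rewrite inE /=.
by apply: funS => /=.
Qed.

Lemma linear_ker_neq0 (F : fieldType) (m k : nat) (G : 'rV[F]_m -> 'rV[F]_k) :
  linear G -> (k < m)%N -> exists2 w, w != 0 & G w = 0.
Proof.
move=> linG km.
pose G' : {linear 'rV[F]_m -> 'rV[F]_k} :=
  HB.pack G (GRing.isLinear.Build _ _ _ _ G linG).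
exists (nz_row (kermx (lin1_mx G'))).
  rewrite nz_row_eq0 -mxrank_eq0 mxrank_ker subn_eq0 -ltnNge.
  exact: leq_ltn_trans (rank_leq_col _) km.
rewrite -[G _]/(G' _) -mul_rV_lin1.
by apply/sub_kermxP; exact: nz_row_sub.
Qed.

Section RealRootedPerturbation.
Context {R : realType}.

(** Each of the finitely many pairs admits all small [d]. The factor 2 makes the intervals of radius
    [d] around the [x i] pairwise disjoint. *)
Lemma separation_radius (m : nat) (x : 'I_m -> R) : injective x ->
  exists2 d : R, 0 < d & forall i j, i != j -> 2 * d < `|x i - x j|.
Proof.
move=> x_inj.
have: \forall d \near (0 : R)^'+,
    forall p : 'I_m * 'I_m, p.1 != p.2 -> 2 * d < `|x p.1 - x p.2|.
  apply: filter_forall => -[i j] /=.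
  have [->|nij] := eqVneq i j; first by near=> d.
  have xij : 0 < `|x i - x j| / 2.
    by rewrite divr_gt0// normr_gt0 subr_eq0 (inj_eq x_inj).
  near=> d => _.
  have : d < `|x i - x j| / 2 by near: d; exact: nbhs_right_lt.
  by rewrite ltr_pdivlMr// mulrC.
move=> sepx.
have [d [d0 sepd]] := filter_ex (filterI (nbhs_right_gt (0 : R)) sepx).
by exists d => // i j; exact: (sepd (i, j)).
Unshelve. all: by end_near. Qed.

(* The sign change of the product across each [x i] survives perturbation, so by
   the intermediate value theorem each root merely moves within its interval. *)
Lemma perturbed_prod_XsubC (m : nat) (x : 'I_m -> R) (h : {poly R}) :
  injective x -> (size h <= m)%N ->
  \forall e \near (0 : R), exists y : 'I_m -> R,
    \prod_i ('X - (x i)%:P) + e *: h = \prod_i ('X - (y i)%:P).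
Proof.
move=> x_inj hm; have [d d0 sepd] := separation_radius x_inj.
set q := \prod_i _.
(* The product of the perturbed values at both ends of the interval, as a polynomial in [e]: by
   continuity its negativity at 0 persists nearby. *)
pose s i : {poly R} := (q.[x i - d]%:P + h.[x i - d] *: 'X) *
                       (q.[x i + d]%:P + h.[x i + d] *: 'X).
have sE i e : (s i).[e] = (q + e *: h).[x i - d] * (q + e *: h).[x i + d].
  by rewrite !hornerE; ring.
have s0 i : (s i).[0] < 0.
  (* The factor of index [i] contributes [- d ^+ 2]; any other contributes
     [(x i - x j) ^+ 2 - d ^+ 2], positive by separation. *)
  rewrite sE scale0r addr0 !horner_prod -big_split/= (bigD1 i)//= !hornerE.
  rewrite nmulr_rlt0; last by nra.
  apply: prodr_gt0 => j ji; rewrite !hornerE.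
  have : 2 * d < `|x i - x j| by apply: sepd; rewrite eq_sym.
  by rewrite ltr_normr => /orP[]; nra.
have : \forall e \near (0 : R), forall i, (s i).[e] < 0.
  apply: (@filter_forall _ _ (fun i => [set e | (s i).[e] < 0]) _
    (nbhs_filter (0 : R))) => i.
  apply: (cvgr_lt (s i).[0]); last exact: s0.
  exact: continuous_horner.
apply: filterS => e se.
have /choice[y yP] i : exists y, (y \in `]x i - d, x i + d[) /\ root (q + e *: h) y.
  have [||y yi ry] := @polyrcf.poly_ivtoo R (q + e *: h) (x i - d) (x i + d).
  - by lra.
  - by rewrite -sE.
  - by exists y.
exists y.
have y_inj : injective y.
  move=> i j yij; apply/eqP/negPn/negP => /sepd.
  have [+ _] := yP i; have [+ _] := yP j; rewrite -yij !in_itv/=.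
  by move=> /andP[? ?] /andP[? ?]; rewrite ltr_normr => /orP[]; lra.
have sq : size q = m.+1 by rewrite /q -big_enum size_prod_XsubC size_enum_ord.
(* The sum thus stays monic of degree [m], so the [m] distinct [y i] exhaust its roots. *)
have seh : (size (e *: h) < size q)%N.
  by rewrite sq ltnS (leq_trans (size_scale_leq _ _)).
have lead1 : lead_coef (q + e *: h) = 1.
  by rewrite lead_coefDl//; apply/eqP/monic_prod_XsubC.
rewrite (@all_roots_prod_XsubC _ (q + e *: h) (codom y)).
- by rewrite lead1 scale1r big_map big_enum.
- by rewrite size_polyDl// sq size_codom card_ord.
- by apply/allP => _ /codomP[i ->]; have [] := yP i.
- by rewrite uniq_rootsE; apply/injectiveP.
Qed.

End RealRootedPerturbation.

Section CoefficientVectors.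
Context {R : realType} (n : nat).

(* The increment of the coordinates of [z] that adds [p] to [fpoly z]. *)
Definition coef_row (p : {poly R}) : 'rV[R]_n :=
  \row_i ((-1) ^+ i.+1 * p`_(n - i.+1)).

Lemma coef_row_linear : linear coef_row.
Proof. by move=> c p q; apply/rowP => i; rewrite !mxE coefD coefZ; ring. Qed.

(** The signs in [coef_row] and [fpoly] cancel. The size bound is there because no coordinate
    reaches the leading term ['X^n]. *)
Lemma fpoly_coef_row (z : 'rV[R]_n) (e : R) (p : {poly R}) : (size p <= n)%N ->
  fpoly (z + e *: coef_row p) = fpoly z + e *: p.
Proof.
move=> pn; rewrite /fpoly -addrA; congr (_ + _).
have pE : p = \sum_(i < n) p`_i *: 'X^i.
  rewrite -[LHS]coefK poly_def (big_ord_widen _ (fun i => p`_i *: 'X^i) pn).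
  rewrite [RHS](bigID (fun i : 'I_n => (i < size p)%N))/= [X in _ + X]big1 ?addr0//.
  by move=> i; rewrite -leqNgt => /leq_sizeP ->//; rewrite scale0r.
rewrite [in RHS]pE scaler_sumr [X in _ = _ + X](reindex_inj rev_ord_inj) -big_split/=.
apply: eq_bigr => i _; rewrite !mxE scalerA -scalerDl; congr (_ *: _).
have sgn : (-1) ^+ i.+1 * (-1) ^+ i.+1 = 1 :> R by rewrite -expr2 sqrr_sign.
rewrite mulrDr; congr (_ + _); move: sgn; set u := (-1) ^+ _ => sgn; set c := p`_ _.
by rewrite mulrCA [u * _]mulrA sgn mul1r.
Qed.

Lemma size_fpoly (z : 'rV[R]_n) : size (fpoly z) = n.+1.
Proof.
rewrite /fpoly size_polyDl size_polyXn// ltnS.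
apply: (leq_trans (size_sum _ _ _)); apply/bigmax_leqP => i _.
rewrite (leq_trans (size_scale_leq _ _))// size_polyXn.
by rewrite ltn_subrL; case: n i => // -[].
Qed.

End CoefficientVectors.

Lemma midpoint_not_extreme (R : realType) (V : lmodType R) (C : set V) (z v : V) :
  C (z + v) -> C (z - v) -> v != 0 -> ~ extreme_point (conv_hull C) z.
Proof.
move=> Czv CzNv /eqP v0 [_].
have h0 : (0 : R) <= 2^-1 by lra.
have h1 : (2^-1 : R) <= 1 by lra.
move=> /(_ (z + v) (z - v) (Itv01 h0 h1))[].
- exact: sub_smallest Czv.
- exact: sub_smallest CzNv.
- by rewrite /=; lra.
- by rewrite /=; lra.
- rewrite /conv/= (_ : unstable.onem _ = 2^-1); last by rewrite /unstable.onem; lra.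
  by rewrite -scalerDr addrCA addrK -mulr2n -[z *+ 2]scaler_nat scalerA mulVf ?scale1r.
- by move=> /(canRL (addKr z)); rewrite addNr.
Qed.

(** A complex root comes either from [r], hence is already a root of [fpoly z], or from a real
    linear factor. *)
Lemma hyperbolic_mul_split (R : realType) (n m : nat) (z z' : 'rV[R]_n)
    (r q : {poly R}) (y : 'I_m -> R) :
  hyperbolic z -> fpoly z = r * q -> fpoly z' = r * \prod_i ('X - (y i)%:P) ->
  hyperbolic z'.
Proof.
move=> hz zE z'E c; rewrite z'E rmorphM rootM => /orP[rc|].
  by apply: hz; rewrite zE rmorphM rootM rc.
rewrite rmorph_prod /root horner_prod => /prodf_eq0[i _].
by rewrite /= map_polyXsubC hornerXsubC subr_eq0 => /eqP->.
Qed.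

Unset Implicit Arguments.
Set Strict Implicit.

Theorem theorem2p8 (R : realType) (n k : nat) (hk : (1 <= k <= n)%N)
    (L : {linear 'rV[R]_n -> 'rV[R]_k}) (L_surj : set_surj setT setT L)
    (a : 'rV[R]_k) :
  locextr (hyperbolic_slice L a) `<=` hyperbolic_slice_boundary k L a.
Proof.
move=> z [[hz Lz] [U [Uz ext]]]; split=> //; split=> //.
apply: contrapT => /card_gt_inj[x x_inj rx].
set q := \prod_i ('X - (x i)%:P).
have sq : size q = k.+2 by rewrite /q -big_enum size_prod_XsubC size_enum_ord.
have q0 : q != 0 by rewrite -size_poly_eq0 sq.
have [r fE] : exists r, fpoly z = r * q.
  have [||r ->] := @uniq_roots_prod_XsubC _ (fpoly z) (codom x).
  - by apply/allP => _ /codomP[i ->]; exact: rx.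
  - by rewrite uniq_rootsE; apply/injectiveP.
  - by exists r; rewrite big_map big_enum.
have r0 : r != 0.
  by apply: contra_eq_neq (size_fpoly z) => r0; rewrite fE r0 mul0r size_poly0.
have sr : (size r + k.+1 = n.+1)%N.
  by rewrite -(size_fpoly z) fE size_mul// sq !addnS.
(* [rVpoly] identifies rows of length [k.+1] with polynomials of degree at most [k]: one dimension
   more than the target of [L]. *)
have [w w0 Lw] : exists2 w : 'rV[R]_k.+1, w != 0 & L (coef_row n (r * rVpoly w)) = 0.
  apply: (@linear_ker_neq0 _ _ _ (fun w => L (coef_row n (r * rVpoly w)))) => // c u v.
  by rewrite linearP mulrDr -scalerAr coef_row_linear linearP.
set h := rVpoly w in Lw; set v := coef_row n _ in Lw.
have sh : (size h <= k.+1)%N by exact: size_poly.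
have h0 : h != 0 by apply: contra_neq w0 => h0; rewrite -(rVpolyK w) -/h h0 linear0.
(* Since [r] has degree [n - k - 1], the product has degree below [n]. *)
have srh : (size (r * h)%R <= n)%N.
  apply: (leq_trans (size_polyMleq _ _)).
  by rewrite -[n]/(n.+1.-1) -sr -!subn1 leq_sub2r // leq_add2l.
have fv e : fpoly (z + e *: v) = r * (q + e *: h).
  by rewrite fpoly_coef_row// fE mulrDr scalerAr.
have v0 : v != 0.
  (* A zero [v] would leave [fpoly z] unchanged at [e = 1], forcing [r * h = 0]. *)
  apply/eqP => v0; have /eqP := fv 1.
  rewrite v0 scaler0 addr0 fE scale1r mulrDr -subr_eq0 opprD addNKr oppr_eq0.
  by rewrite mulf_eq0 (negPf r0) (negPf h0).
have inC : \forall e \near (0 : R), (hyperbolic_slice L a `&` U) (z + e *: v).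
  have Ue : \forall e \near (0 : R), U (z + e *: v).
    have cv : z + e *: v @[e --> (0 : R)] --> z.
      rewrite -[X in _ --> X]addr0 -(scale0r v).
      by apply: cvgD; [exact: cvg_cst|apply: cvgZr_tmp; exact: cvg_id].
    exact: cv.
  near=> e; split; last by near: e.
  split; last by rewrite /= linearD linearZ/= Lw scaler0 addr0.
  have [y yE] : exists y : 'I_k.+1 -> R, q + e *: h = \prod_i ('X - (y i)%:P).
    by near: e; exact: perturbed_prod_XsubC.
  by apply: (hyperbolic_mul_split hz fE); rewrite fv yE.
have inCN : \forall e \near (0 : R), (hyperbolic_slice L a `&` U) (z - e *: v).
  have oppC : - e @[e --> (0 : R)] --> (0 : R).
    by rewrite -[X in _ --> X]oppr0; apply: cvgN; exact: cvg_id.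
  by near=> e; rewrite -scaleNr; near: e; exact: (oppC _ inC).
(* Choosing [e] to the right of 0 makes the segment nontrivial. *)
have [e [[Ce CNe] e0]] := @filter_ex _ (0 : R)^'+ _ _
  (filterI (cvg_within _ (filterI inC inCN)) (nbhs_right_gt 0)).
by apply: (midpoint_not_extreme Ce CNe _ ext); rewrite scaler_eq0 negb_or (gt_eqF e0).
Unshelve. all: by end_near. Qed.
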